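(* Let $H$ be a graph and let $G$ be the complement of the line graph of $H$. Then the local chromatic number of $G$ equals its chromatic number: $\psi(G)=\chi(G)$.
   Context: Graphs are finite and simple. The complement of the line graph of a graph $H$ is the graph whose vertices are the edges of $H$, two of them being adjacent exactly when they are disjoint (share no endpoint) as edges of $H$. For a graph $G=(V,E)$ and $v\in V$, the closed neighborhood is $N[v]=\{u\in V : u \text{ is a neighbor of } v\}\cup\{v\}$. The local chromatic number is $\psi(G)=\min_c\max_{v\in V}|c(N[v])|$, where the minimum is over all proper colorings $c$ of $G$ (with any number of colors). $\chi(G)$ is the usual chromatic number. *)

(* Defs.v *)
From mathcomp Require Import all_boot.
From mathcomp Require Import boolp.

Set Implicit Arguments.
Unset Strict Implicit.
Unset Printing Implicit Defensive.

Record sgraph := SGraph {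
  vertex :> finType;
  adj : rel vertex;
  adj_sym : symmetric adj;
  adj_irrefl : irreflexive adj }.

Arguments adj {s} x y.

Definition edges (H : sgraph) : {set {set H}} :=
  [set A : {set H} | [exists x, exists y, adj x y && (A == [set x; y])]].

Definition edge (H : sgraph) : finType := {A : {set H} | A \in edges H}.

Definition edge_disjoint (H : sgraph) : rel (edge H) :=
  fun A B => [disjoint val A & val B].

Lemma edge_disjoint_sym (H : sgraph) : symmetric (@edge_disjoint H).
Proof. by move=> A B; rewrite /edge_disjoint disjoint_sym. Qed.

Lemma edge_disjoint_irrefl (H : sgraph) : irreflexive (@edge_disjoint H).
Proof.
move=> [A HA]; rewrite /edge_disjoint /=; apply/negP => /pred0P dA.
move: HA; rewrite inE => /existsP[x /existsP[y /andP[_ /eqP eA]]].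
by have := dA x; rewrite /= eA set21.
Qed.

Definition compl_line_graph (H : sgraph) : sgraph :=
  SGraph (@edge_disjoint_sym H) (@edge_disjoint_irrefl H).

Definition proper_coloring (G : sgraph) (C : eqType) (c : G -> C) : Prop :=
  forall u v : G, adj u v -> c u != c v.

Definition closed_nbhd (G : sgraph) (v : G) : {set G} :=
  [set u | adj v u || (u == v)].

Definition num_colors (G : sgraph) (C : eqType) (c : G -> C) (A : {set G}) :
  nat := size (undup [seq c u | u in A]).

Definition max_local_colors (G : sgraph) (C : eqType) (c : G -> C) : nat :=
  \max_(v : G) num_colors c (closed_nbhd v).

Lemma enum_rank_proper (G : sgraph) :
  proper_coloring (enum_rank : G -> 'I_#|G|).
Proof.
move=> u v uv; apply/negP => /eqP/enum_rank_inj e.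
by move: uv; rewrite e adj_irrefl.
Qed.

Lemma ex_chromatic (G : sgraph) :
  exists k, `[< exists c : G -> 'I_k, proper_coloring c >].
Proof. by exists #|G|; apply/asboolP; exists enum_rank; apply: enum_rank_proper. Qed.

Definition chromatic_number (G : sgraph) : nat := ex_minn (ex_chromatic G).

(* Since G is finite, colorings with colors in nat account, up to renaming of
   the colors, for all colorings with any number of colors. *)
Lemma ex_local_chromatic (G : sgraph) :
  exists k, `[< exists c : G -> nat,
                  proper_coloring c /\ max_local_colors c = k >].
Proof.
pose c (u : G) : nat := enum_rank u.
exists (max_local_colors c); apply/asboolP; exists c; split=> //.
exact: (@enum_rank_proper G).
Qed.

Definition local_chromatic_number (G : sgraph) : nat :=
  ex_minn (ex_local_chromatic G).

(* Main.v *)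
Require Import Defs.
From mathcomp Require Import all_boot.
From mathcomp Require Import boolp zify.

(** Fix a proper coloring [c] of [G] with [m] colors in which every closed
    neighborhood sees at most [k] colors; we look for a proper [k]-coloring.
    Every edge [e] of [H] misses at least [m - k] colors.
    - If the union of two color classes is independent in [G], identify the two
      colors: this preserves properness and the local bound, and [m] drops.
    - If [m = k + 1], any one class can be dissolved, giving each of its members
      a color that it misses: members of one class are pairwise non-adjacent, so
      they cannot conflict with each other.
    - If no two classes can be merged, then [m <= k + 1].  Otherwise every edge
      misses at least two colors, so the pairs (edge, missed color) number at
      least [2 |E(H)|].  No class is a singleton (it could be merged with a class
      missed by its element), and a class is an intersecting family of edges: if
      it is a triangle no edge misses it, and if it is a star with center [v]
      then fewer than [deg v] edges miss it.  Distinct classes have distinct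
      centers, since stars with a common center can be merged, so there are
      fewer than [\sum_v deg v = 2 |E(H)|] such pairs. *)

Set Implicit Arguments.
Unset Strict Implicit.
Unset Printing Implicit Defensive.

(** * Missed colors, dissolving and merging classes in an arbitrary graph *)

Lemma num_colors_card (G : sgraph) (C : finType) (c : G -> C) (A : {set G}) :
  num_colors c A = #|c @: A|.
Proof.
rewrite /num_colors -(card_uniqP (undup_uniq _)); apply: eq_card => x.
by rewrite mem_undup; apply/imageP/imsetP => -[u uA ->]; exists u.
Qed.

Lemma num_colors_comp (G : sgraph) (C D : eqType) (f : C -> D) (c : G -> C)
    (A : {set G}) :
  num_colors (f \o c) A <= num_colors c A.
Proof.
rewrite /num_colors -(size_map f (undup _)); apply: uniq_leq_size.
  exact: undup_uniq.
move=> y; rewrite mem_undup => /imageP[u uA ->]; apply: map_f.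
by rewrite mem_undup; apply/imageP; exists u.
Qed.

Section ColoringsOfGraphs.

Variables (G : sgraph) (C : finType).
Implicit Types (c : G -> C) (u v : G) (i j : C).

Definition missed c u : {set C} := (c @: setT) :\: (c @: closed_nbhd u).

Lemma missedP c u i :
  reflect [/\ i \in c @: setT, c u != i & forall v, c v = i -> ~~ adj u v]
          (i \in missed c u).
Proof.
rewrite inE; apply: (iffP andP) => [[iN iT]|[iT ui vi]]; split=> //.
- apply: contra iN => /eqP <-; apply: imset_f.
  by rewrite inE eqxx orbT.
- move=> v vi; apply: contra iN => uv; rewrite -vi; apply: imset_f.
  by rewrite inE uv.
- apply/imsetP => -[v]; rewrite inE => /orP[uv|/eqP ->] ei.
    by have := vi v (esym ei); rewrite uv.
  by rewrite ei eqxx in ui.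
Qed.

Lemma card_missed c u :
  #|missed c u| + #|c @: closed_nbhd u| = #|c @: setT|.
Proof.
rewrite addnC -(cardsID (c @: closed_nbhd u) (c @: setT)).
by rewrite (setIidPr _) // imsetS.
Qed.

Lemma proper_coloring_ord c k :
  proper_coloring c -> #|c @: setT| <= k ->
  exists d : G -> 'I_k, proper_coloring d.
Proof.
move=> c_proper le_k; have cT u : c u \in c @: setT by apply: imset_f.
exists (fun u => widen_ord le_k (enum_rank_in (cT u) (c u))) => u v uv.
apply: contra (c_proper _ _ uv) => /eqP/(congr1 val) /= /val_inj e.
by apply/eqP/(enum_rank_in_inj _ _ e).
Qed.

Lemma dissolve_class c u0 :
  proper_coloring c -> (forall u, 0 < #|missed c u|) ->
  exists2 d : G -> C,
    proper_coloring d & #|d @: setT| < #|c @: setT|.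
Proof.
move=> c_proper c_missed.
have [g gP] : {g : G -> C & forall u, g u \in missed c u}.
  by apply: (@choice _ _ (fun u i => i \in missed c u)) => u; apply/card_gt0P.
have g_adj u v : c v = g u -> adj u v = false.
  by case/missedP: (gP u) => _ _ gu /gu /negbTE.
exists (fun u => if c u == c u0 then g u else c u).
  move=> u v uv.
  case: (c u =P c u0) => [eu|_]; case: (c v =P c u0) => [ev|_].
  - by move: (c_proper _ _ uv); rewrite eu ev eqxx.
  - by apply: contraTneq uv => /esym/g_adj ->.
  - by apply: contraTneq uv => /g_adj; rewrite adj_sym => ->.
  - exact: c_proper.
(* No new color appears, as missed colors are in use, and [c u0] disappears, as a color missed by
   [u] differs from [c u]. *)
apply/proper_card/properP; split.
  apply/subsetP => i /imsetP[u _ ->]; case: eqP => _; last exact: imset_f.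
  by case/missedP: (gP u).
exists (c u0); first exact: imset_f.
apply/imsetP => -[u _]; case: eqP => [eu e|eu /esym //].
by case/missedP: (gP u) => _; rewrite eu e eqxx.
Qed.

Definition mergeable c i j := forall u v, c u = i -> c v = j -> ~~ adj u v.

Lemma merge_classes c i j :
  proper_coloring c -> i \in c @: setT -> j \in c @: setT -> i != j ->
  mergeable c i j ->
  exists d : G -> C,
    [/\ proper_coloring d, #|d @: setT| < #|c @: setT|
      & forall A : {set G}, #|d @: A| <= #|c @: A|].
Proof.
move=> c_proper iT jT ij mij; pose f l := if l == i then j else l.
exists (f \o c); split=> [u v uv||A]; last by rewrite imset_comp leq_imset_card.
- rewrite /f /=; case: (c u =P i) => [eu|_]; case: (c v =P i) => [ev|_].
  + by move: (c_proper _ _ uv); rewrite eu ev eqxx.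
  + by apply: contraTneq uv => /esym/(mij _ _ eu).
  + by apply: contraTneq uv => eu; rewrite adj_sym; apply: mij.
  + exact: c_proper.
- apply/proper_card/properP; split.
    by apply/subsetP => l /imsetP[u _ ->]; rewrite /f /=; case: eqP => _ //;
      apply: imset_f.
  exists i => //; apply/imsetP => -[u _]; rewrite /f /=.
  by case: eqP => [_ e|eu /esym //]; rewrite e eqxx in ij.
Qed.

Lemma unmergeable_class_gt1 c u :
  (forall i j, i \in c @: setT -> j \in c @: setT -> i != j ->
     ~ mergeable c i j) ->
  0 < #|missed c u| -> exists2 v, v != u & c v = c u.
Proof.
move=> unm /card_gt0P[j /missedP[jT uj uadj]]; apply: contrapT => nv.
apply: (unm (c u) j (imset_f _ (in_setT u)) jT uj) => w v wu vj.
have [->|wNu] := eqVneq w u; first exact: uadj.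
by case: nv; exists w.
Qed.

End ColoringsOfGraphs.

(** * Stars and intersecting families of edges *)

Section EdgeFamilies.

Variable H : sgraph.
Implicit Types (e f : edge H) (x y v : H) (D X : {set edge H}).

Definition star v : {set edge H} := [set e : edge H | v \in val e].

Lemma card_edge e : #|val e| = 2.
Proof.
case: e => A /=; rewrite inE => /existsP[x /existsP[y /andP[xy /eqP ->]]].
by rewrite cards2; case: eqP xy => // ->; rewrite adj_irrefl.
Qed.

Lemma edge_pairE e x y : x != y -> x \in val e -> y \in val e ->
  val e = [set x; y].
Proof.
move=> xy xe ye; apply/eqP; rewrite eq_sym eqEcard card_edge cards2 xy andbT.
by apply/subsetP => z; rewrite !inE => /orP[] /eqP ->.
Qed.

Lemma edge_other e v : v \in val e -> exists2 x, v != x & val e = [set v; x].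
Proof.
move=> ve; have : 0 < #|val e :\ v|.
  by have := cardsD1 v (val e); rewrite card_edge ve; lia.
case/card_gt0P => x; rewrite !inE => /andP[xv xe]; rewrite eq_sym in xv.
by exists x => //; apply: edge_pairE.
Qed.

Lemma edge_disjointPn e f :
  reflect (exists2 x, x \in val e & x \in val f) (~~ edge_disjoint e f).
Proof.
apply: (iffP idP) => [|[x xe xf]].
  by case/pred0Pn => x /andP[xe xf]; exists x.
by apply/pred0Pn; exists x; rewrite /= xe.
Qed.

Lemma sum_card_star : \sum_(v : H) #|star v| = 2 * #|edge H|.
Proof.
transitivity (\sum_v \sum_(e : edge H) (v \in val e : nat)).
  by apply: eq_bigr => v _; rewrite -sum1dep_card big_mkcond.
rewrite exchange_big /= -sum1_card big_distrr /=; apply: eq_bigr => e _.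
by rewrite -big_mkcond sum1_card card_edge.
Qed.

(** Write [f] as [{v, a}] and [g] as [{v, b}]. If all of [D] contains [v], the members of [X]
    through [v] avoid [f] and [g], and one that avoids [v] must be [{a, b}]: at most [deg v - 2 + 1]
    in all. Otherwise [D] contains a triangle, and an edge meeting all three sides is itself a side,
    so [X] would be empty. *)
Lemma intersecting_center D X f g :
  f \in D -> g \in D -> f != g ->
  {in D &, forall d e, ~~ edge_disjoint d e} ->
  {in X & D, forall d e, ~~ edge_disjoint d e} ->
  [disjoint X & D] -> 0 < #|X| ->
  exists2 v, {in D, forall e, v \in val e} & #|X| < #|star v|.
Proof.
move=> fD gD fg DD XD XDdisj /card_gt0P[e0 e0X].
have meet d e : ~~ edge_disjoint d e ->
    forall x y, val e = [set x; y] -> (x \in val d) || (y \in val d).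
  move=> /edge_disjointPn[z zd ze] x y exy; move: ze.
  by rewrite exy !inE => /orP[] /eqP <-; rewrite zd ?orbT.
have /edge_disjointPn[v vf vg] := DD _ _ fD gD.
have [a va fE] := edge_other vf; have [b vb gE] := edge_other vg.
have ab : a != b.
  by apply: contra fg => /eqP ab; rewrite -val_eqE fE gE ab.
have outside e : ~~ edge_disjoint e f -> ~~ edge_disjoint e g ->
    v \notin val e -> val e = [set a; b].
  move=> /meet/(_ _ _ fE) ef /meet/(_ _ _ gE) eg /negbTE ve.
  by rewrite !ve /= in ef eg; apply: edge_pairE.
have [Dv|] := boolP [forall (e | e \in D), v \in val e].
  exists v => [e eD|]; first by move/forallP/(_ e)/implyP: Dv; apply.
  rewrite -(cardsID (star v) X).
  have : #|X :\: star v| <= 1.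
    apply/card_le1_eqP => d e; rewrite !inE => /andP[vd dX] /andP[ve eX].
    apply: val_inj; transitivity [set a; b]; last symmetry;
      by apply: outside => //; apply: XD.
  have : X :&: star v \subset star v :\ f :\ g.
    apply/subsetP => e; rewrite !inE => /andP[eX ->]; rewrite andbT.
    by apply/andP; split; apply: contraTneq eX => ->;
      rewrite (disjointFl XDdisj).
  have fS : f \in star v by rewrite inE.
  have gS : g \in star v :\ f by rewrite !inE eq_sym fg.
  rewrite (cardsD1 f (star v)) fS (cardsD1 g (star v :\ f)) gS.
  move=> /subset_leq_card le2 le1; apply: leq_ltn_trans (leq_add le2 le1) _.
  by rewrite addn1 !add1n.
case/forallPn => h; rewrite negb_imply => /andP[hD vh].
have hE : val h = [set a; b] by apply: outside => //; apply: DD.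
(* [f], [g], [h] form a triangle, so [e0] contains two of its vertices. *)
have XDF d : d \in D -> (val d == val e0) = false.
  move=> dD; apply: contraTF e0X => /eqP/val_inj <-.
  by rewrite (disjointFl XDdisj).
have e0f := meet _ _ (XD _ _ e0X fD) _ _ fE.
have e0g := meet _ _ (XD _ _ e0X gD) _ _ gE.
have e0h := meet _ _ (XD _ _ e0X hD) _ _ hE.
suff: [|| val f == val e0, val g == val e0 | val h == val e0].
  by rewrite (XDF f fD) (XDF g gD) (XDF h hD).
have [ve|ve] := boolP (v \in val e0).
  by case/orP: e0h => xe; rewrite fE gE (edge_pairE _ ve xe) // eqxx ?orbT.
rewrite (negbTE ve) /= in e0f e0g.
by rewrite hE (edge_pairE ab e0f e0g) eqxx !orbT.
Qed.

End EdgeFamilies.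

(** * Reduction of locally bounded colorings by double counting *)

Section ColoringsOfComplLineGraphs.

Variables (H : sgraph) (C : finType).
Local Notation G := (compl_line_graph H).
Implicit Types (c : G -> C).

Lemma unmergeable_missed c :
  proper_coloring c ->
  (forall i j, i \in c @: setT -> j \in c @: setT -> i != j ->
     ~ mergeable c i j) ->
  0 < #|G| -> exists u : G, #|missed c u| <= 1.
Proof.
move=> c_proper unm G_gt0; apply: contrapT => nu.
have missed_gt1 (u : G) : 1 < #|missed c u|.
  by rewrite ltnNge; apply/negP => le1; apply: nu; exists u.
pose X i : {set G} := [set u | i \in missed c u].
(* Colors missed by nobody are left out of the sum: their classes, such as triangles, may have no
   center. *)
have sumX : \sum_(i | 0 < #|X i|) #|X i| = \sum_(u : G) #|missed c u|.
  transitivity (\sum_i \sum_(u : G) (i \in missed c u : nat)).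
    rewrite big_mkcond; apply: eq_bigr => i _.
    rewrite (_ : \sum_u _ = #|X i|); first by case: posnP => // ->.
    by rewrite /X -sum1dep_card [RHS]big_mkcond.
  rewrite exchange_big; apply: eq_bigr => u _.
  by rewrite -big_mkcond sum1_card.
have sumX_ge : 2 * #|G| <= \sum_(i | 0 < #|X i|) #|X i|.
  rewrite sumX -sum1_card big_distrr /=; apply: leq_sum => u _.
  exact: missed_gt1.
have in_X i u : (u \in X i) = (i \in missed c u) by rewrite in_set.
have X_used i : 0 < #|X i| -> i \in c @: setT.
  by case/card_gt0P => u; rewrite in_X => /missedP[].
have center i : 0 < #|X i| ->
    exists2 v : H, (forall u : G, c u = i -> v \in val u) & #|X i| < #|star v|.
  move=> Xi_gt0; case/imsetP: (X_used i Xi_gt0) => f _ ei.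
  rewrite {i}ei in Xi_gt0 *.
  have [g gf cg] := unmergeable_class_gt1 unm (ltnW (missed_gt1 f)).
  pose D : {set G} := [set u | c u == c f].
  have in_D u : (u \in D) = (c u == c f) by rewrite in_set.
  have := @intersecting_center H D (X (c f)) g f.
  case=> [|||d e|d e||//|v vD Xv]; rewrite ?in_X ?in_D ?cg //.
  - move=> /eqP cd /eqP ce; apply/negP => /(c_proper d e).
    by rewrite cd ce eqxx.
  - by move=> /missedP[_ _ nadj] /eqP /nadj.
  - apply/pred0P => u /=; rewrite in_X in_D; apply/negP => /andP[].
    by case/missedP => _ /negbTE ->.
  - by exists v => // u cu; apply: vD; rewrite in_D cu.
(* This color makes the final inequality strict; its center [v0] is the default value of [v] on
   colors missed by nobody. *)
have [i0 i0P] : exists i, 0 < #|X i|.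
  apply: contrapT => nX; move: sumX_ge; rewrite big1; first by lia.
  by move=> i Xi; case: nX; exists i.
have [v0 _ _] := center i0 i0P.
have [v vP] : {v : C -> H & forall i, 0 < #|X i| ->
    (forall u : G, c u = i -> v i \in val u) /\ #|X i| < #|star (v i)|}.
  apply: (@choice _ _ (fun i v => 0 < #|X i| ->
    (forall u : G, c u = i -> v \in val u) /\ #|X i| < #|star v|)) => i.
  have [/center[w ? ?]|_] := boolP (0 < #|X i|); first by exists w.
  by exists v0.
(* Edges through a common center are never disjoint, so two classes sharing it would be
   mergeable. *)
have v_inj : {in [pred i | 0 < #|X i|] &, injective v}.
  move=> i j; rewrite !inE => Xi Xj vij; apply: contrapT => /eqP ij.
  apply: (unm i j (X_used _ Xi) (X_used _ Xj) ij) => u w cu cw.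
  apply/edge_disjointPn; exists (v i); first by case: (vP i Xi) => + _; apply.
  by rewrite vij; case: (vP j Xj) => + _; apply.
suff: \sum_(i | 0 < #|X i|) #|X i| < 2 * #|G| by rewrite ltnNge sumX_ge.
rewrite -sum_card_star; apply: (@leq_trans (\sum_(i | 0 < #|X i|) #|star (v i)|)).
  rewrite (bigD1 i0) //= [X in _ < X](bigD1 i0) //= -addSn leq_add //.
    by case: (vP i0 i0P).
  by apply: leq_sum => i /andP[Xi _]; case: (vP i Xi) => _ /ltnW.
rewrite -(big_imset (fun x => #|star x|) v_inj) /=.
by rewrite [leqRHS](bigID [in v @: [pred i | 0 < #|X i|]]) /= leq_addr.
Qed.

(** Induction on the number of colors in use, with [k] fixed: merging keeps the local bound, and
    dissolving, which may break it, occurs only as the last step. *)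
Lemma local_coloring_reduce c k :
  proper_coloring c -> (forall u : G, #|c @: closed_nbhd u| <= k) ->
  exists2 d : G -> C, proper_coloring d & #|d @: setT| <= k.
Proof.
have [m] := ubnP #|c @: setT|; elim: m c => // m IHm c le_m c_proper c_loc.
have [le_k|gt_k] := leqP #|c @: setT| k; first by exists c.
have [[i [j [iT jT ij mij]]]|nm] := pselect (exists i j,
    [/\ i \in c @: setT, j \in c @: setT, i != j & mergeable c i j]).
  have [d [d_proper d_lt d_loc]] := merge_classes c_proper iT jT ij mij.
  by apply: (IHm d) => // [|u]; [lia|exact: leq_trans (d_loc _) _].
have unm i j : i \in c @: setT -> j \in c @: setT -> i != j ->
    ~ mergeable c i j.
  by move=> iT jT ij mij; apply: nm; exists i, j.
have [_ /imsetP[u0 _ _]] := card_gt0P (leq_ltn_trans (leq0n k) gt_k).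
have G_gt0 : 0 < #|G| by apply/card_gt0P; exists u0.
have [u le1] := unmergeable_missed c_proper unm G_gt0.
have missed_gt0 (w : G) : 0 < #|missed c w|.
  by have := card_missed c w; have := c_loc w; lia.
have [d d_proper d_lt] := dissolve_class u0 c_proper missed_gt0.
(* Since [u] misses at most one color and sees at most [k], [c] uses at most [k + 1] colors, and [d]
   uses fewer. *)
by exists d => //; have := card_missed c u; have := c_loc u; lia.
Qed.

End ColoringsOfComplLineGraphs.

(** * The two inequalities between the chromatic numbers *)

Lemma local_chromatic_le (G : sgraph) :
  local_chromatic_number G <= chromatic_number G.
Proof.
rewrite /local_chromatic_number /chromatic_number.
case: ex_minnP => l _ l_min; case: ex_minnP => k /asboolP[c c_proper] _.
pose d := @nat_of_ord k \o c.
apply: (@leq_trans (max_local_colors d)).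
  by apply/l_min/asboolP; exists d; split.
apply/bigmax_leqP => v _; apply: leq_trans (num_colors_comp _ _ _) _.
by rewrite num_colors_card -[leqRHS]card_ord max_card.
Qed.

Theorem theorem1 (H : sgraph) :
  local_chromatic_number (compl_line_graph H) =
  chromatic_number (compl_line_graph H).
Proof.
apply/eqP; rewrite eqn_leq local_chromatic_le /=.
rewrite /local_chromatic_number /chromatic_number.
case: ex_minnP => k /asboolP[d d_proper] k_min.
case: ex_minnP => l /asboolP[c [c_proper <-]] _; apply/k_min/asboolP.
(* The reduction needs a finite color type; [inord] is injective on the values of [c], all at most
   [n]. *)
pose n := \max_u c u; pose f : nat -> 'I_n.+1 := inord.
have fc_proper : proper_coloring (f \o c).
  move=> u v /c_proper; apply: contra => /eqP/(congr1 val) /=.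
  by rewrite !inordK ?ltnS ?leq_bigmax // => ->.
have fc_loc u : #|(f \o c) @: closed_nbhd u| <= max_local_colors c.
  rewrite -num_colors_card; apply: leq_trans (num_colors_comp _ _ _) _.
  exact: leq_bigmax.
have [e e_proper] := local_coloring_reduce fc_proper fc_loc.
exact: proper_coloring_ord.
Qed.
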